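(* Let $f:I\to\mathbb{R}$, with $I\subset\mathbb{R}$ an open interval, have a sufficient number of continuous derivatives in a neighborhood of $\alpha\in I$, where $\alpha$ is a simple root of $f$. Consider the two-step iterative method $$y_n=x_n-\frac{f(x_n)}{f'(x_n)},\qquad x_{n+1}=x_n-A(t)\,\frac{f(x_n)}{f'(x_n)},\qquad t=\frac{f'(y_n)}{f'(x_n)},$$ where $A$ is a real-valued weight function. Then this method has third-order convergence when the weight function $A$ satisfies $$A(1)=1,\qquad A'(1)=-\tfrac12,\qquad |A''(1)|<+\infty .$$
   Context: A root $\alpha$ of $f$ is simple if $f(\alpha)=0$ and $f'(\alpha)\neq 0$. Order of convergence: let $f$ be a real-valued function with a simple root $\alpha$ and let $(x_n)$ be a sequence of real numbers that converges to $\alpha$. The order of convergence $m\in\mathbb{R}^+$ is given by $$\lim_{n\to\infty}\frac{x_{n+1}-\alpha}{(x_n-\alpha)^m}=\zeta\neq 0,$$ where $\zeta$ is the asymptotic error constant. Third-order convergence of the method means that this holds with $m=3$ for the sequence $(x_n)$ generated by the method and converging to $\alpha$.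
   Formalization: Order exactly three is claimed only if 2(1-A''(1))c_2^2+c_3/2 is nonzero, where c_j=f^(j)(α)/(j! f'(α)); otherwise (e.g. f=x+x^4, A=1-(t-1)/2) the limit is 0. In all cases the error quotient is shown to tend to this constant, for sequences that never hit α. *)

(* Defs.v *)
From Stdlib Require Import Reals.
From Coquelicot Require Import Coquelicot.
Open Scope R_scope.

(* Bounded or unbounded open interval. *)
Definition Rbar_open_interval (a b : Rbar) (x : R) : Prop :=
  Rbar_lt a x /\ Rbar_lt x b.

(* [Derive] and [Derive_n] are total, with junk values where the function is
   not differentiable, so existence is required on a whole neighborhood. *)
Definition C_near (k : nat) (f : R -> R) (x0 : R) : Prop :=
  locally x0 (fun x => (forall j, (j <= k)%nat -> ex_derive_n f j x) /\
                       continuous (Derive_n f k) x).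

(* The second derivative of [A] at [t0] exists (as a real number). *)
Definition twice_derivable_at (A : R -> R) (t0 : R) : Prop :=
  locally t0 (fun t => ex_derive A t) /\ ex_derive (Derive A) t0.

Definition simple_root (f : R -> R) (alpha : R) : Prop :=
  f alpha = 0 /\ ex_derive f alpha /\ Derive f alpha <> 0.

(* The errors are signed, so the exponent is a positive integer: a real power
   of a negative error would be meaningless. *)
Definition has_order (x : nat -> R) (alpha : R) (m : nat) : Prop :=
  (0 < m)%nat /\
  exists zeta : R, zeta <> 0 /\
    is_lim_seq (fun n => (x (S n) - alpha) / (x n - alpha) ^ m) zeta.

Definition newton (f : R -> R) (x : R) : R := x - f x / Derive f x.

Definition step (A f : R -> R) (x : R) : R :=
  let t := Derive f (newton f x) / Derive f x in
  x - A t * (f x / Derive f x).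

(* Every quantity used by the iteration is well defined: [f] matters only on
   [I], and no derivative or quotient takes a junk value. *)
Definition generated (I : R -> Prop) (A f : R -> R) (x : nat -> R) : Prop :=
  forall n,
    (I (x n) /\ ex_derive f (x n) /\ Derive f (x n) <> 0) /\
    (I (newton f (x n)) /\ ex_derive f (newton f (x n))) /\
    x (S n) = step A f (x n).

(* [x n <> alpha] makes the error quotients meaningful: an iteration that
   reaches [alpha] is constant from then on. *)
Definition converging_run (I : R -> Prop) (A f : R -> R) (alpha : R)
    (x : nat -> R) : Prop :=
  generated I A f x /\ is_lim_seq x alpha /\ (forall n, x n <> alpha).

Definition method_has_order (I : R -> Prop) (A f : R -> R) (alpha : R)
    (m : nat) : Prop :=
  forall x, converging_run I A f alpha x -> has_order x alpha m.

(* With [c2], [c3] the Taylor coefficients of [f] at [alpha] divided by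
   [f' alpha], this is the coefficient of [e ^ 3] in the expansion of
   [step A f (alpha + e) - alpha]. It may vanish, e.g. when
   [f x = x + x ^ 4] and [alpha = 0]; the order is then not 3. *)
Definition error_constant (A f : R -> R) (alpha : R) : R :=
  let c2 := Derive_n f 2 alpha / (2 * Derive f alpha) in
  let c3 := Derive_n f 3 alpha / (6 * Derive f alpha) in
  2 * (1 - Derive_n A 2 1) * c2 ^ 2 + c3 / 2.

(* Main.v *)
(** Expanding [f], [f'] and [A] to the order at which the remainder is a factor
    continuous at the center turns [(step A f x - alpha) / (x - alpha) ^ 3] into
    an exact rational expression in those factors.  The conditions [A 1 = 1] and
    [A' 1 = -1/2] cancel the terms of order 1 and 2 in [x - alpha], so that no
    division by [x - alpha] is left and the limit follows by continuity. *)

Require Import Defs.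
From Stdlib Require Import Reals Lra Lia.
From Coquelicot Require Import Coquelicot.
Open Scope R_scope.

(** * Limits along sequences, and Taylor expansions with a continuous remainder factor *)

Lemma is_lim_seq_comp_continuous (g : R -> R) (u : nat -> R) (l : R) :
  continuous g l -> is_lim_seq u l -> is_lim_seq (fun n => g (u n)) (g l).
Proof.
  intros Hg Hu.
  apply is_lim_seq_continuous; [|exact Hu].
  now apply continuity_pt_filterlim.
Qed.

(** The mean value theorem replaces integration: [h x = s c * (c - x0) ^ n * (x - x0)] with [c]
    between [x0] and [x], and [c] is no farther from [x0] than [x] is, so the quotient by
    [(x - x0) ^ S n] is at most [Rabs (s c)], which tends to 0. *)
Lemma peano_integrate (h s : R -> R) (x0 : R) (n : nat) :
  locally x0 (fun x => is_derive h x (s x * (x - x0) ^ n)) ->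
  h x0 = 0 -> continuous s x0 -> s x0 = 0 ->
  exists r, continuous r x0 /\ r x0 = 0 /\
    forall x, h x = r x * (x - x0) ^ S n.
Proof.
  intros Hd H0 Hs Hs0.
  (* At [x0] the numerator is 0, so this quotient is 0 there whatever value the inverse of 0 has. *)
  exists (fun x => h x / (x - x0) ^ S n).
  assert (Hr0 : h x0 / (x0 - x0) ^ S n = 0) by (rewrite H0; apply Rmult_0_l).
  split; [|split; [exact Hr0|]].
  - apply filterlim_locally; intros eps.
    assert (Hse : locally x0 (fun x => ball (s x0) eps (s x)))
      by exact (proj1 (filterlim_locally s (s x0)) Hs eps).
    destruct (filter_and _ _ Hd Hse) as [delta Hdelta].
    exists delta; intros x Hx.
    rewrite Hr0.
    destruct (Req_dec x x0) as [->|Hne].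
    { rewrite Hr0; apply ball_center. }
    assert (Hin : forall z, Rmin x0 x <= z <= Rmax x0 x -> Rabs (z - x0) <= Rabs (x - x0)).
    { intros z; unfold Rmin, Rmax, Rabs.
      destruct (Rle_dec x0 x), (Rcase_abs (z - x0)), (Rcase_abs (x - x0)); lra. }
    assert (Hball : forall z, Rmin x0 x <= z <= Rmax x0 x -> ball x0 delta z).
    { intros z Hz; apply Rle_lt_trans with (2 := Hx); exact (Hin z Hz). }
    destruct (MVT_gen h x0 x (fun z => s z * (z - x0) ^ n)) as [c [Hc Heq]].
    { intros z Hz; apply Hdelta, Hball; lra. }
    { intros z Hz; apply continuity_pt_filterlim.
      apply (ex_derive_continuous h).
      eexists; apply Hdelta, (Hball z Hz). }
    assert (Hsc : Rabs (s c) < eps).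
    { destruct (Hdelta c (Hball c Hc)) as [_ Hb].
      rewrite Hs0 in Hb; change (Rabs (s c - 0) < eps) in Hb.
      now rewrite Rminus_0_r in Hb. }
    change (Rabs (h x / (x - x0) ^ S n - 0) < eps).
    assert (Hp : 0 < Rabs (x - x0)) by (apply Rabs_pos_lt; lra).
    replace (h x / (x - x0) ^ S n - 0) with (s c * ((c - x0) ^ n / (x - x0) ^ n)).
    2:{ rewrite H0, Rminus_0_r in Heq; rewrite Heq; simpl; field.
        split; [apply pow_nonzero|]; lra. }
    rewrite Rabs_mult.
    apply Rle_lt_trans with (2 := Hsc).
    rewrite <- (Rmult_1_r (Rabs (s c))) at 2.
    apply Rmult_le_compat_l; [apply Rabs_pos|].
    rewrite Rabs_div by (apply pow_nonzero; lra).
    rewrite <- !RPow_abs.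
    apply Rle_div_l; [now apply pow_lt|].
    rewrite Rmult_1_l.
    apply pow_incr; split; [apply Rabs_pos|exact (Hin c Hc)].
  - intros x; destruct (Req_dec x x0) as [->|Hne].
    + rewrite Hr0, H0; ring.
    + field; apply pow_nonzero; lra.
Qed.

(** Carathéodory's form of differentiability: the difference quotient, completed at [x0] by the
    derivative, is continuous there. *)
Lemma peano1 (g : R -> R) (x0 : R) :
  ex_derive g x0 ->
  exists q, continuous q x0 /\ q x0 = Derive g x0 /\
    forall x, g x = g x0 + q x * (x - x0).
Proof.
  intros Hg.
  exists (fun x => if Req_EM_T x x0 then Derive g x0 else (g x - g x0) / (x - x0)).
  split; [|split].
  - apply filterlim_locally; intros eps.
    destruct (Req_EM_T x0 x0) as [_|]; [|easy].
    pose proof (proj1 (is_derive_Reals _ _ _) (Derive_correct g x0 Hg)) as Hd.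
    destruct (Hd eps (cond_pos eps)) as [delta Hdelta].
    exists delta; intros x Hx.
    destruct (Req_EM_T x x0) as [|Hne]; [apply ball_center|].
    specialize (Hdelta (x - x0)).
    rewrite Rplus_minus in Hdelta.
    apply Hdelta; [lra|exact Hx].
  - now destruct (Req_EM_T x0 x0).
  - intros x; destruct (Req_EM_T x x0) as [->|Hne]; [ring|field; lra].
Qed.

(** With [Derive g] expanded by [peano1], the difference between [g] and its Taylor polynomial of
    degree 2 has derivative [(q x - q x0) * (x - x0)]. By [peano_integrate] it is a vanishing factor
    times [(x - x0) ^ 2]; adding back the top coefficient gives [r]. *)
Lemma peano2 (g : R -> R) (x0 : R) :
  locally x0 (ex_derive g) -> ex_derive (Derive g) x0 ->
  exists r, continuous r x0 /\ r x0 = Derive_n g 2 x0 / 2 /\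
    forall x, g x = g x0 + Derive g x0 * (x - x0) + r x * (x - x0) ^ 2.
Proof.
  intros Hg Hg'.
  destruct (peano1 _ _ Hg') as [q [Hq [Hq0 Eq]]].
  destruct (peano_integrate
    (fun x => g x - g x0 - Derive g x0 * (x - x0) - Derive_n g 2 x0 / 2 * (x - x0) ^ 2)
    (fun x => q x - Derive_n g 2 x0) x0 1) as [r [Hr [Hr0 Er]]].
  - apply (filter_imp (ex_derive g)); [|exact Hg].
    intros x Hx; auto_derive; [exact Hx|].
    change (Derive (fun x1 => g x1) x) with (Derive g x).
    rewrite (Eq x); simpl; field.
  - ring.
  - apply (continuous_minus q); [exact Hq|apply continuous_const].
  - rewrite Hq0; apply Rminus_diag_eq; reflexivity.
  - exists (fun x => r x + Derive_n g 2 x0 / 2); split; [|split].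
    + apply (continuous_plus r); [exact Hr|apply continuous_const].
    + rewrite Hr0; apply Rplus_0_l.
    + intros x; specialize (Er x); simpl in Er |- *; lra.
Qed.

(** The argument of [peano2] one order higher, with [Derive g] now expanded by [peano2]. *)
Lemma peano3 (g : R -> R) (x0 : R) :
  locally x0 (fun x => ex_derive g x /\ ex_derive (Derive g) x) ->
  ex_derive (Derive_n g 2) x0 ->
  exists r, continuous r x0 /\ r x0 = Derive_n g 3 x0 / 6 /\
    forall x, g x = g x0 + Derive g x0 * (x - x0)
                    + Derive_n g 2 x0 / 2 * (x - x0) ^ 2 + r x * (x - x0) ^ 3.
Proof.
  intros Hg Hg''.
  destruct (peano2 (Derive g) x0) as [q [Hq [Hq0 Eq]]]; [|exact Hg''|].
  { revert Hg; apply filter_imp; tauto. }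
  change (Derive_n (Derive g) 2 x0) with (Derive_n g 3 x0) in Hq0.
  change (Derive (Derive g) x0) with (Derive_n g 2 x0) in Eq.
  destruct (peano_integrate
    (fun x => g x - g x0 - Derive g x0 * (x - x0) - Derive_n g 2 x0 / 2 * (x - x0) ^ 2
              - Derive_n g 3 x0 / 6 * (x - x0) ^ 3)
    (fun x => q x - Derive_n g 3 x0 / 2) x0 2) as [r [Hr [Hr0 Er]]].
  - revert Hg; apply filter_imp.
    intros x [Hx _]; auto_derive; [exact Hx|].
    change (Derive (fun x1 => g x1) x) with (Derive g x).
    rewrite (Eq x); simpl; field.
  - ring.
  - apply (continuous_minus q); [exact Hq|apply continuous_const].
  - rewrite Hq0; ring.
  - exists (fun x => r x + Derive_n g 3 x0 / 6); split; [|split].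
    + apply (continuous_plus r); [exact Hr|apply continuous_const].
    + rewrite Hr0; apply Rplus_0_l.
    + intros x; specialize (Er x); simpl in Er |- *; lra.
Qed.

(** * The error of one step: exact identity and limit *)

(* Here [e = x - alpha], [fx = f x], [dx = f' x], [t] is the argument of [A],
   [Y = (newton f x - alpha) / e ^ 2] and [T = (t - 1) / e]. *)
Lemma step_error_identity (e d c r s q w fx dx Y T t At : R) :
  e <> 0 -> dx <> 0 ->
  fx = d * e + c * e ^ 2 + r * e ^ 3 ->
  dx = d + 2 * c * e + s * e ^ 2 ->
  Y = (c + (s - r) * e) / dx ->
  T = (q * Y * e - 2 * c - s * e) / dx ->
  t = (d + q * (e ^ 2 * Y)) / dx ->
  At = 1 - (t - 1) / 2 + w * (t - 1) ^ 2 ->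
  (e - At * (fx / dx)) / e ^ 3 =
  (s - r + (q * Y - s) / 2) / dx - T * Y / 2 - w * T ^ 2 * (1 - e * Y).
Proof.
  intros He Hdx Hfx Ed HY HT Ht HA.
  assert (Hu : fx / dx = e - e ^ 2 * Y).
  { rewrite HY, Hfx; apply Rmult_eq_reg_r with dx; [|exact Hdx].
    field_simplify; [|exact Hdx|exact Hdx]; rewrite Ed; ring. }
  assert (HtT : t - 1 = e * T).
  { rewrite HT, Ht; apply Rmult_eq_reg_r with dx; [|exact Hdx].
    field_simplify; [|exact Hdx|exact Hdx]; rewrite Ed; ring. }
  assert (HYd : Y * dx = c + (s - r) * e) by (rewrite HY; field; exact Hdx).
  assert (HTd : T * dx = q * Y * e - 2 * c - s * e) by (rewrite HT; field; exact Hdx).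
  rewrite HA, HtT, Hu.
  (* The second-order cancellation: the constant terms of [Y * dx] and [T * dx / 2] are [c] and
     [- c], so a factor [e] comes out. The slope -1/2 of the weight is what pairs [Y] with
     [T / 2]. *)
  assert (Key : Y + T / 2 = e * ((s - r + (q * Y - s) / 2) / dx)).
  { apply Rmult_eq_reg_r with dx; [|exact Hdx].
    replace ((Y + T / 2) * dx) with (Y * dx + T * dx / 2) by field.
    rewrite HYd, HTd; field; exact Hdx. }
  replace (e - (1 - e * T / 2 + w * (e * T) ^ 2) * (e - e ^ 2 * Y))
    with (e ^ 2 * (Y + T / 2) - e ^ 3 * (T * Y / 2) - e ^ 3 * (w * T ^ 2 * (1 - e * Y)))
    by field.
  rewrite Key; field; now split.
Qed.

(** The limit concerns the map [step] alone, so [x] may be any sequence tending to [alpha] that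
    avoids [alpha] and the zeros of [f'], generated by the iteration or not. *)
Lemma step_error_limit (f A : R -> R) (alpha : R) (x : nat -> R) :
  C_near 3 f alpha -> simple_root f alpha ->
  A 1 = 1 -> Derive A 1 = - (1 / 2) -> twice_derivable_at A 1 ->
  is_lim_seq x alpha ->
  (forall n, x n <> alpha) -> (forall n, Derive f (x n) <> 0) ->
  is_lim_seq (fun n => (step A f (x n) - alpha) / (x n - alpha) ^ 3)
             (error_constant A f alpha).
Proof.
  intros Hf [Hfa [_ Hd]] HA0 HA1 [HA Hdd] Hx Hxa Hdx.
  pose proof (locally_singleton _ _ Hf) as [Hfj _].
  destruct (peano3 f alpha) as [r [Hr [Hr0 Er]]].
  { revert Hf; unfold C_near; apply filter_imp; intros z [Hz _].
    exact (conj (Hz 1%nat ltac:(lia)) (Hz 2%nat ltac:(lia))). }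
  { exact (Hfj 3%nat ltac:(lia)). }
  destruct (peano2 (Derive f) alpha) as [s [Hs [Hs0 Es]]].
  { revert Hf; unfold C_near; apply filter_imp; intros z [Hz _]; exact (Hz 2%nat ltac:(lia)). }
  { exact (Hfj 3%nat ltac:(lia)). }
  (* A second, shorter expansion of [f'], meant for the Newton point: its error is already of order
     2, so one term suffices. *)
  destruct (peano1 (Derive f) alpha (Hfj 2%nat ltac:(lia))) as [q [Hq [Hq0 Eq]]].
  destruct (peano2 A 1 HA Hdd) as [w [Hw [Hw0 Ew]]].
  change (Derive_n (Derive f) 2 alpha) with (Derive_n f 3 alpha) in Hs0.
  change (Derive (Derive f) alpha) with (Derive_n f 2 alpha) in Es, Hq0.
  set (d := Derive f alpha) in *.
  set (f2 := Derive_n f 2 alpha) in *; set (f3 := Derive_n f 3 alpha) in *.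
  (* [Y] comes from [e * f' - f = f2 / 2 * e ^ 2 + (s - r) * e ^ 3] with [e = x n - alpha], and [T]
     from the difference of the two expansions of [f']; the powers of [e] are divided out
     beforehand, so both have limits. *)
  set (Y := fun n => (f2 / 2 + (s (x n) - r (x n)) * (x n - alpha)) / Derive f (x n)).
  set (y := fun n => newton f (x n)).
  set (T := fun n => (q (y n) * Y n * (x n - alpha) - 2 * (f2 / 2)
                      - s (x n) * (x n - alpha)) / Derive f (x n)).
  set (t := fun n => Derive f (y n) / Derive f (x n)).
  assert (Hy : forall n, y n = alpha + (x n - alpha) ^ 2 * Y n).
  { intros n; unfold y, newton, Y.
    apply Rmult_eq_reg_r with (Derive f (x n)); [|apply Hdx].
    field_simplify; [|apply Hdx|apply Hdx].
    rewrite (Er (x n)), (Es (x n)), Hfa; field. }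
  assert (Lr : is_lim_seq (fun n => r (x n)) (f3 / 6))
    by (rewrite <- Hr0; now apply is_lim_seq_comp_continuous).
  assert (Ls : is_lim_seq (fun n => s (x n)) (f3 / 2))
    by (rewrite <- Hs0; now apply is_lim_seq_comp_continuous).
  assert (Le : is_lim_seq (fun n => x n - alpha) 0).
  { replace 0 with (alpha - alpha) by ring.
    apply is_lim_seq_minus'; [exact Hx|apply is_lim_seq_const]. }
  assert (Ld : forall u, is_lim_seq u alpha -> is_lim_seq (fun n => Derive f (u n)) d).
  { intros u Hu; apply is_lim_seq_comp_continuous; [|exact Hu].
    apply (ex_derive_continuous (Derive f)); exact (Hfj 2%nat ltac:(lia)). }
  assert (LY : is_lim_seq Y (f2 / 2 / d)).
  { replace (f2 / 2 / d) with ((f2 / 2 + (f3 / 2 - f3 / 6) * 0) / d) by (field; exact Hd).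
    apply is_lim_seq_div'; [|now apply Ld|exact Hd].
    apply is_lim_seq_plus'; [apply is_lim_seq_const|].
    apply is_lim_seq_mult'; [|exact Le].
    now apply is_lim_seq_minus'. }
  assert (Ly : is_lim_seq y alpha).
  { apply is_lim_seq_ext with (fun n => alpha + (x n - alpha) * (x n - alpha) * Y n).
    { intros n; rewrite Hy; ring. }
    replace (Finite alpha) with (Finite (alpha + 0 * 0 * (f2 / 2 / d))) by (f_equal; ring).
    apply is_lim_seq_plus'; [apply is_lim_seq_const|].
    apply is_lim_seq_mult'; [|exact LY].
    now apply is_lim_seq_mult'. }
  assert (Lq : is_lim_seq (fun n => q (y n)) f2)
    by (rewrite <- Hq0; now apply is_lim_seq_comp_continuous).
  assert (LT : is_lim_seq T (- f2 / d)).
  { replace (- f2 / d) with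
      ((f2 * (f2 / 2 / d) * 0 - 2 * (f2 / 2) - f3 / 2 * 0) / d) by (field; exact Hd).
    apply is_lim_seq_div'; [|now apply Ld|exact Hd].
    apply is_lim_seq_minus'; [|now apply is_lim_seq_mult'].
    apply is_lim_seq_minus'; [|apply is_lim_seq_const].
    apply is_lim_seq_mult'; [|exact Le].
    now apply is_lim_seq_mult'. }
  assert (Lw : is_lim_seq (fun n => w (t n)) (Derive_n A 2 1 / 2)).
  { rewrite <- Hw0; apply is_lim_seq_comp_continuous; [exact Hw|].
    replace 1 with (d / d) by (field; exact Hd).
    apply is_lim_seq_div'; [now apply Ld|now apply Ld|exact Hd]. }
  (* The square of [T n] is written as a product so that the limit rule for products applies. *)
  apply is_lim_seq_ext with (fun n =>
    (s (x n) - r (x n) + (q (y n) * Y n - s (x n)) / 2) / Derive f (x n)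
    - T n * Y n / 2 - w (t n) * (T n * T n) * (1 - (x n - alpha) * Y n)).
  { intros n.
    replace (T n * T n) with (T n ^ 2) by ring.
    rewrite <- (step_error_identity (x n - alpha) d (f2 / 2) (r (x n)) (s (x n)) (q (y n))
      (w (t n)) (f (x n)) (Derive f (x n)) (Y n) (T n) (t n) (A (t n)));
      try reflexivity; try apply Hdx.
    - f_equal; unfold step; fold (y n); fold (t n); cbv zeta; ring.
    - specialize (Hxa n); lra.
    - rewrite (Er (x n)), Hfa; ring.
    - rewrite (Es (x n)); field.
    - unfold t at 1; rewrite (Eq (y n)), (Hy n) at 1; f_equal; rewrite (Hy n); ring.
    - rewrite (Ew (t n)), HA0, HA1; field. }
  (* Termwise limit. In the notation of [error_constant], [Y] tends to [c2], [T] to [-2 * c2] and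
     [w] to [A''(1) / 2]; the third derivative contributes [2 * c3 - 3 / 2 * c3 = c3 / 2]. *)
  replace (error_constant A f alpha) with
    ((f3 / 2 - f3 / 6 + (f2 * (f2 / 2 / d) - f3 / 2) / 2) / d
     - (- f2 / d) * (f2 / 2 / d) / 2
     - Derive_n A 2 1 / 2 * ((- f2 / d) * (- f2 / d)) * (1 - 0 * (f2 / 2 / d))).
  2:{ unfold error_constant; fold d f2 f3; field; exact Hd. }
  repeat first
    [ assumption
    | apply Ld; assumption
    | apply is_lim_seq_const
    | apply is_lim_seq_minus'
    | apply is_lim_seq_plus'
    | apply is_lim_seq_div'; [| |first [exact Hd|lra]]
    | apply is_lim_seq_mult' ].
Qed.

(** The limit of the error quotients is proved first for every run, even when its value is 0; a
    nonzero value then serves as the asymptotic error constant. *)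
Theorem theorem2p1 (a b : Rbar) (f A : R -> R) (alpha : R)
  (Halpha : Rbar_open_interval a b alpha)
  (Hf : C_near 3 f alpha)
  (Hroot : simple_root f alpha)
  (HA0 : A 1 = 1)
  (HA1 : Derive A 1 = - (1 / 2))
  (HA2 : twice_derivable_at A 1) :
  (error_constant A f alpha <> 0 ->
     method_has_order (Rbar_open_interval a b) A f alpha 3) /\
  (forall x : nat -> R, converging_run (Rbar_open_interval a b) A f alpha x ->
     is_lim_seq (fun n => (x (S n) - alpha) / (x n - alpha) ^ 3)
                (error_constant A f alpha)).
Proof.
  assert (Hlim : forall x, converging_run (Rbar_open_interval a b) A f alpha x ->
     is_lim_seq (fun n => (x (S n) - alpha) / (x n - alpha) ^ 3)
                (error_constant A f alpha)).
  { intros x [Hgen [Hx Hne]].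
    apply is_lim_seq_ext with (fun n => (step A f (x n) - alpha) / (x n - alpha) ^ 3).
    { intros n; destruct (Hgen n) as [_ [_ ->]]; reflexivity. }
    apply step_error_limit; try assumption.
    intros n; apply Hgen. }
  split; [|exact Hlim].
  intros Hz x Hx; split; [lia|].
  exists (error_constant A f alpha); split; [exact Hz|exact (Hlim x Hx)].
Qed.
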